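(* Let $G=(V,E,\sigma,o)$ be a radially symmetric tree with radially symmetric weight $\sigma$. Suppose $p_0\in(1,\infty)$ and $\mathrm{Mod}_{p,\sigma}(\Gamma_\infty)>0$ for all $p$ in a neighborhood of $p_0$. Then the function $p\mapsto\mathrm{Mod}_{p,\sigma}(\Gamma_\infty)$ is continuous at $p_0$.
   Context: A weighted rooted tree $G=(V,E,\sigma,o)$ has root $o$ and weights $\sigma:E\to\mathbb{R}_{>0}$. The generation of an edge is the number of edges on the unique path from $o$ ending with it; $e$ is the parent of $e'$ if they are adjacent and $e'$ has generation one more. A proper infinite tree is infinite, locally finite, and every edge has at least one child; it is radially symmetric if the number of children of an edge depends only on its generation; $\sigma$ is radially symmetric if $\sigma(e)$ depends only on the generation of $e$. A descending path is a path $e_1e_2\cdots$ from $o$ with $e_i$ the parent of $e_{i+1}$; $\Gamma_\infty$ is the set of infinite descending paths. For $\rho:E\to[0,\infty)$, $\ell_\rho(\gamma)=\sum_{e\in\gamma}\rho(e)$; $\mathrm{Adm}(\Gamma_\infty)$ consists of $\rho\ge0$ with $\ell_\rho(\gamma)\ge1$ for all $\gamma\in\Gamma_\infty$; $\mathcal{E}_{p,\sigma}(\rho)=\sum_e\sigma(e)\rho(e)^p$; $\mathrm{Mod}_{p,\sigma}(\Gamma_\infty)=\inf_{\rho\in\mathrm{Adm}(\Gamma_\infty)}\mathcal{E}_{p,\sigma}(\rho)$. *)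

(* Defs.v *)
From HB Require Import structures.
From mathcomp Require Import all_boot all_order all_algebra finmap.
From mathcomp Require Import all_classical all_reals all_analysis.

Set Implicit Arguments.
Unset Strict Implicit.
Unset Printing Implicit Defensive.

Import Order.TTheory GRing.Theory Num.Theory numFieldNormedType.Exports.

Local Open Scope classical_set_scope.
Local Open Scope ring_scope.

Definition edge_rel (V : choiceType) (E : set {fset V}) : rel V :=
  fun x y => [fset x; y]%fset \in E.

(* A cycle of length at most 2 is degenerate: a vertex sequence [:: x; y] with
   x adjacent to y satisfies [cycle] by traversing the same edge twice. *)
Definition is_tree (V : choiceType) (E : set {fset V}) : Prop :=
  (forall x y : V, exists2 p : seq V, path (edge_rel E) x p & last x p = y) /\
  (forall c : seq V, cycle (edge_rel E) c -> uniq c -> (size c <= 2)%N).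

(* The weight is a total function on finite sets of vertices, but only its
   values on edges matter; the same convention is used for densities below. *)
Record weightedRootedTree (R : realType) := WeightedRootedTree {
  vertex : choiceType ;
  edges : set {fset vertex} ;
  weight : {fset vertex} -> R ;
  tree_root : vertex ;
  edges_card2 : forall e, edges e -> #|` e|%fset = 2%N ;
  edges_tree : is_tree edges ;
  weight_gt0 : forall e, edges e -> 0 < weight e
}.

Section Tree.
Context {R : realType} (G : weightedRootedTree R).
Local Notation V := (vertex G).
Local Notation E := (@edges R G).
Local Notation edge := {fset V}.
Implicit Types (e : edge) (rho : edge -> R) (gamma : nat -> edge).

(* The path from the root visits the vertices [tree_root G :: p]; its successive
   edges are listed by [pairmap]. *)
Definition root_path_to e (p : seq V) : Prop :=
  [/\ path (edge_rel E) (tree_root G) p, uniq (tree_root G :: p) &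
      exists s, pairmap (fun x y => [fset x; y]%fset) (tree_root G) p = rcons s e].

(* The path is unique, so this set is a singleton when e is an edge; the
   value 0 is only taken off the edge set. *)
Definition generation e : nat :=
  xget 0%N [set n | exists2 p, root_path_to e p & size p = n].

Definition edge_adjacent e e' : Prop :=
  e <> e' /\ exists2 x : V, x \in e & x \in e'.

Definition is_parent e e' : Prop :=
  [/\ E e, E e', edge_adjacent e e' & generation e' = (generation e).+1].

Definition children e : set edge := [set e' | is_parent e e'].

Definition proper_infinite : Prop :=
  [/\ infinite_set [set: V],
      forall x : V, finite_set [set e | E e /\ x \in e] &
      forall e, E e -> children e !=set0].

Definition radially_symmetric_tree : Prop :=
  proper_infinite /\
  forall e e', E e -> E e' -> generation e = generation e' ->
    (children e #= children e')%card.

Definition radially_symmetric_weight : Prop :=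
  forall e e', E e -> E e' -> generation e = generation e' ->
    weight e = weight e'.

(* [gamma i] is the edge of index i + 1 in the usual one-based numbering. *)
Definition infinite_path_from (o : V) gamma : Prop :=
  exists x : nat -> V,
    [/\ x 0%N = o, injective x &
        forall i, E (gamma i) /\ gamma i = [fset x i; x i.+1]%fset].

Definition Gamma_infty : set (nat -> edge) :=
  [set gamma | infinite_path_from (tree_root G) gamma /\
               forall i, is_parent (gamma i) (gamma i.+1)].

Local Open Scope ereal_scope.

Definition path_length rho gamma : \bar R :=
  \sum_(0 <= i <oo) (rho (gamma i))%:E.

Definition Adm (Gamma : set (nat -> edge)) : set (edge -> R) :=
  [set rho | (forall e, E e -> (0 <= rho e)%R) /\
             forall gamma, Gamma gamma -> 1 <= path_length rho gamma].

Definition energy (p : R) rho : \bar R :=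
  \esum_(e in E) (weight e * rho e `^ p)%:E.

Definition Modulus (p : R) (Gamma : set (nat -> edge)) : \bar R :=
  ereal_inf [set energy p rho | rho in Adm Gamma].

End Tree.

Arguments Gamma_infty {R} G.
Arguments Modulus {R} G p Gamma.

(* Main.v *)
(* Write s_n for the total weight of the edges of generation n + 1 and
   w_n(p) = s_n^(-1/(p-1)).  Averaging over generations shows that
   Mod_p = (sum_n w_n(p))^(1-p): radial densities proportional to w_n give <=,
   and for >= one bounds rho^p below by its tangent at the optimal radial
   density (Young's inequality) and uses that the generation averages of an
   admissible rho sum to at least 1.  The latter holds because a path which
   always moves to a child with smallest expected remaining length is no longer
   than the average path.  Positivity of Mod_p near p0 makes the series finite
   at some a < p0 < b, and w_n(p) <= w_n(a) + w_n(b) on [a, b] gives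
   continuity by domination. *)
Require Import Defs.
From HB Require Import structures.
From mathcomp Require Import all_boot all_order all_algebra finmap.
From mathcomp Require Import all_classical all_reals all_analysis.
From mathcomp Require Import ring lra.
Import Order.TTheory GRing.Theory Num.Theory numFieldNormedType.Exports.
Local Open Scope classical_set_scope.
Local Open Scope ring_scope.
Set Implicit Arguments.
Unset Strict Implicit.
Unset Printing Implicit Defensive.

(** * Inequalities for real powers *)

Lemma young_powR (R : realType) (p x c : R) : 1 < p -> 0 <= x -> 0 < c ->
  p * (x * c `^ (p - 1)) <= x `^ p + (p - 1) * c `^ p.
Proof.
move=> p1 x0 c0; have p0 : 0 < p by lra.
have pN0 : p != 0 by lra.
have pB0 : p - 1 != 0 by lra.
have q0 : 0 < p / (p - 1) by rewrite divr_gt0 // subr_gt0.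
(* The exponent conjugate to p is p/(p-1), and raising c^(p-1) to it gives c^p. *)
have := @conjugate_powR R x (c `^ (p - 1)) p (p / (p - 1)) x0 (powR_ge0 _ _) p0 q0.
rewrite -powRrM mulrCA divff // mulr1 => /(_ _)/(ler_wpM2l (ltW p0)).
move=> le; apply: (le_trans (le _)).
  by field; rewrite pN0 pB0.
by rewrite le_eqVlt; apply/orP; left; apply/eqP; field; rewrite pN0 pB0.
Qed.

(** Compare logarithms: t^(1-p) is decreasing in t, with inverse t^(-1/(p-1)). This converts bounds
    on the modulus into bounds on the dual series and back. *)
Lemma le_powR_onem (R : realType) (p x y : R) : 1 < p -> 0 < x -> 0 < y ->
  (x <= y `^ (1 - p)) = (y <= x `^ (- (p - 1)^-1)).
Proof.
move=> p1 x0 y0; have pB0 : p - 1 != 0 by lra.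
have pV : 0 < p - 1 by lra.
rewrite -ler_ln ?posrE ?powR_gt0 // -[RHS]ler_ln ?posrE ?powR_gt0 // !ln_powR.
by rewrite -[RHS](ler_pM2l pV) mulrA mulrN divff // mulN1r lerNr -mulNr opprB.
Qed.

(** * The optimal radial profile *)

Section DualWeight.
Variables (R : realType) (s : nat -> R).
Hypothesis s0 : forall n, 0 < s n.

(* Sequences proportional to this one minimise [sum_n s n * t n `^ p] for a
   fixed value of [sum_n t n]. *)
Definition dual_weight (p : R) n : R := s n `^ (- (p - 1)^-1).

Lemma dual_weight_gt0 p n : 0 < dual_weight p n.
Proof. exact: powR_gt0. Qed.

Lemma dual_weight_powRB1 p n : 1 < p -> s n * dual_weight p n `^ (p - 1) = 1.
Proof.
move=> p1; rewrite -powRrM mulNr mulVf ?subr_eq0 ?gt_eqF //.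
by rewrite powRN powRr1 ?divff ?gt_eqF // ltW.
Qed.

(** The Euler-Lagrange condition of the radial problem: the right-hand side does not depend on n, so
    at the optimum every generation has the same marginal cost. *)
Lemma dual_weight_scaled_powRB1 p n W : 1 < p -> 0 < W ->
  s n * (dual_weight p n / W) `^ (p - 1) = W `^ (1 - p).
Proof.
move=> p1 W0; have w0 := ltW (dual_weight_gt0 p n).
have W'0 : 0 <= W^-1 by rewrite invr_ge0 ltW.
rewrite (powRM _ w0 W'0) mulrA dual_weight_powRB1 // mul1r.
by rewrite -(powR_inv1 (ltW W0)) -powRrM mulN1r opprB.
Qed.

Lemma dual_weight_scaled_powR p n W : 1 < p -> 0 < W ->
  s n * (dual_weight p n / W) `^ p = W `^ (1 - p) * (dual_weight p n / W).
Proof.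
move=> p1 W0; rewrite -(@dual_weight_scaled_powRB1 p n W) //.
rewrite -mulrA [X in _ = _ * X]mulrC mulr_powRB1 ?divr_ge0 ?ltW ?dual_weight_gt0 //.
by lra.
Qed.

(** The exponent -1/(p-1) increases with p, so the power is largest at b when s n is at least 1, and
    at a otherwise. The sum covers both cases uniformly in n. *)
Lemma dual_weight_le p a b n : 1 < a -> a <= p <= b ->
  dual_weight p n <= dual_weight a n + dual_weight b n.
Proof.
move=> a1 /andP[ap pb]; rewrite /dual_weight.
have [s1|s1] := leP 1 (s n).
  rewrite (le_trans (y := dual_weight b n)) ?lerDr ?powR_ge0 // ler_powR //.
  by rewrite lerN2 lef_pV2 ?posrE ?subr_gt0 ?lerB //; lra.
rewrite (le_trans (y := dual_weight a n)) ?lerDl ?powR_ge0 // ger_powR //.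
  by rewrite s0 ltW.
by rewrite lerN2 lef_pV2 ?posrE ?subr_gt0 ?lerB //; lra.
Qed.

End DualWeight.

(** * Continuity of dominated series *)

Section SeriesContinuity.
Variables (R : realType) (f : nat -> R -> R) (g : nat -> R) (p0 : R).
Hypothesis f0 : forall n p, 0 <= f n p.
Hypothesis g_cvg : (\sum_(0 <= n <oo) (g n)%:E < +oo)%E.
Hypothesis fg : \forall p \near p0, forall n, f n p <= g n.
Hypothesis f_cont : forall n, {for p0, continuous (f n)}.

Lemma continuous_dominated_series :
  {for p0, continuous (fun p => fine (\sum_(0 <= n <oo) (f n p)%:E)%E)}.
Proof.
have g0 n : 0 <= g n by apply: le_trans (f0 n p0) _; exact: (nbhs_singleton fg).
have tail0 : (\sum_(m <= n <oo) (g n)%:E)%E @[m --> \oo] --> 0%E.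
  by apply: nneseries_tail_cvg => // n _; rewrite lee_fin.
apply/cvgrPdist_lt => e e0.
have e3 : 0 < e / 3 by rewrite divr_gt0.
have [m tailm] : exists m, (\sum_(m <= n <oo) (g n)%:E < (e / 3)%:E)%E.
  have : \forall m \near \oo, (\sum_(m <= n <oo) (g n)%:E < (e / 3)%:E)%E.
    have e30 : (0%:E < (e / 3)%:E)%E by rewrite lte_fin.
    exact: tail0 _ (open_ereal_lt' e30).
  by case=> m _ /(_ m (leqnn m)); exists m.
(* The tail is squeezed between 0 and e/3, hence finite, so [fine] returns the true sum and splits
   additively. *)
have fin_tail p : (forall n, f n p <= g n) ->
    exists2 t, fine (\sum_(0 <= n <oo) (f n p)%:E)%E = \sum_(0 <= n < m) f n p + t
      & 0 <= t < e / 3.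
  move=> fgp.
  have : (\sum_(m <= n <oo) (f n p)%:E < (e / 3)%:E)%E.
    by apply: le_lt_trans tailm; apply: lee_nneseries => [n _ _|n _]; rewrite lee_fin.
  have : (0 <= \sum_(m <= n <oo) (f n p)%:E)%E.
    by apply: nneseries_ge0 => n _ _; rewrite lee_fin.
  rewrite (nneseries_split 0 m); last by move=> n _; rewrite lee_fin.
  rewrite add0n sumEFin.
  case: (\sum_(m <= n <oo) (f n p)%:E)%E => [t| |] //=.
  by rewrite lee_fin lte_fin => t0 te; exists t => //; rewrite t0.
have Sc : (\sum_(0 <= n < m) f n p) @[p --> p0] --> \sum_(0 <= n < m) f n p0.
  elim: (m) => [|k IH].
    by rewrite big_nil; under eq_fun do rewrite big_nil; exact: cvg_cst.
  rewrite big_nat_recr //=; under eq_fun do rewrite big_nat_recr //=.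
  by apply: cvgD => //; exact: f_cont.
near=> p.
have [t -> /andP[t0 te]] := fin_tail p0 (nbhs_singleton fg).
have [|t' -> /andP[t'0 t'e]] := fin_tail p; first by near: p.
have : `|\sum_(0 <= n < m) f n p0 - \sum_(0 <= n < m) f n p| < e / 3.
  by near: p; move/cvgrPdist_lt : Sc; apply.
rewrite !ltr_norml => /andP[]; move=> *; apply/andP; split; lra.
Unshelve. all: by end_near. Qed.

End SeriesContinuity.

Lemma continuous_dual_weight (R : realType) (s : nat -> R) (p0 : R) n :
  (forall n, 0 < s n) -> 1 < p0 -> {for p0, continuous (fun p => dual_weight s p n)}.
Proof.
move=> s0 p01.
rewrite (_ : (fun p => _) = fun p => expR (- (p - 1)^-1 * ln (s n))); last first.
  by apply/funext => p; rewrite /dual_weight /powR gt_eqF.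
apply: continuous_comp; last exact: continuous_expR.
apply: cvgMl; apply: cvgN; apply: cvgV; first by rewrite subr_eq0 gt_eqF.
by apply: cvgB; [exact: cvg_id|exact: cvg_cst].
Qed.

(** * Finite lists and simple paths *)

Lemma seq_argmin (R : realType) (T : eqType) (s : seq T) (f : T -> \bar R) : s != [::] ->
  exists2 x, x \in s & forall y, y \in s -> (f x <= f y)%E.
Proof.
elim: s => // a [_ _|b s IH _].
  by exists a => [|y]; rewrite inE // => /eqP ->.
have [//|x xs xmin] := IH.
have [fxa|fax] := leP (f x) (f a).
  by exists x => [|y]; rewrite inE ?xs ?orbT // => /orP[/eqP -> //|]; exact: xmin.
exists a => [|y]; rewrite inE ?eqxx // => /orP[/eqP -> //|/xmin].
exact/le_trans/ltW.
Qed.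

Lemma seq_le_average (R : realType) (T : eqType) (s : seq T) (f : T -> \bar R) :
  s != [::] ->
  exists2 x, x \in s & (f x <= ((size s)%:R^-1)%:E * \sum_(y <- s) f y)%E.
Proof.
move=> s0; have [x xs xmin] := seq_argmin f s0.
exists x => //.
have sz : (0 < (size s)%:R :> R) by rewrite ltr0n lt0n size_eq0.
rewrite lee_pdivlMl // mule_natl.
elim: s xmin {s0 xs sz} => [_|a s IH xmin]; first by rewrite big_nil.
rewrite big_cons muleS leeD ?xmin ?mem_head // IH // => y ys.
by rewrite xmin // inE ys orbT.
Qed.

(** If two such paths leave o by different vertices, follow each up to their first meeting point z:
    this closes a simple cycle through o. The length bound leaves only o and z on it, so both paths
    begin with z, a contradiction. *)
Lemma simple_path_unique (T : eqType) (e : rel T) :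
  symmetric e -> (forall c, cycle e c -> uniq c -> (size c <= 2)%N) ->
  forall o p q, path e o p -> uniq (o :: p) -> path e o q -> uniq (o :: q) ->
    last o p = last o q -> p = q.
Proof.
move=> esym acyc o p; elim: p o => [|a p IH] o [|b q] //=.
- by move=> _ _ _ /andP[oq _] oE; rewrite oE mem_last in oq.
- by move=> _ /andP[op _] _ _ oE; rewrite -oE mem_last in op.
move=> /andP[oa pa] /andP[oap uap] /andP[ob qb] /andP[obq ubq] lE.
have [ab|ab] := eqVneq a b.
  by subst b; congr cons; exact: (IH a).
exfalso.
(* The first vertex of the first path lying on the second; it exists because the endpoints agree. *)
pose z := nth o (a :: p) (find [in b :: q] (a :: p)).
have hz : has [in b :: q] (a :: p).
  by apply/hasP; exists (last a p); rewrite ?mem_last // lE mem_last.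
have zq : z \in b :: q by exact: (nth_find o hz).
have zlt : (find [in b :: q] (a :: p) < size (a :: p))%N by rewrite -has_find.
have [p1 [p2 [pE pq]]] : exists p1 p2, a :: p = p1 ++ z :: p2 /\
    forall x, x \in p1 -> x \notin b :: q.
  exists (take (find [in b :: q] (a :: p)) (a :: p)),
         (drop (find [in b :: q] (a :: p)).+1 (a :: p)).
  split; first by rewrite -drop_nth // cat_take_drop.
  move=> x /(nthP o)[i]; rewrite size_take zlt => ilt <-.
  by rewrite nth_take //; have := before_find o ilt => /= ->.
have [q1 [q2 qE]] : exists q1 q2, b :: q = q1 ++ z :: q2.
  by move: zq => /path.splitPr[q1 q2]; exists q1, q2.
have pap : path e o (a :: p) by rewrite /= oa.
have pbq : path e o (b :: q) by rewrite /= ob.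
have uap' : uniq (o :: a :: p) by rewrite /= oap.
have ubq' : uniq (o :: b :: q) by rewrite /= obq.
rewrite pE cat_path /= in pap; rewrite pE -cat_cons cat_uniq /= in uap'.
rewrite qE cat_path /= in pbq; rewrite qE -cat_cons cat_uniq /= in ubq'.
case/and3P: pap => pp1 pz _; case/and3P: pbq => pq1 qz _.
have := acyc (o :: p1 ++ z :: rev q1); rewrite /cycle /= rcons_cat cat_path /=.
rewrite pp1 pz /= -rev_cons.
have -> : path e z (rev (o :: q1)).
  have := rev_path e o (rcons q1 z); rewrite last_rcons belast_rcons => ->.
  by rewrite (eq_path (e' := e)) ?rcons_path ?pq1.
move=> /(_ isT).
case/andP: uap' => /= /andP[oNp1 up1] /andP[/norP[/norP[zNo zp1] _] _].
case/andP: ubq' => /= /andP[oNq1 uq1] /andP[/norP[/norP[_ zq1] _] _].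
rewrite mem_cat inE mem_rev (negbTE oNp1) (negbTE oNq1) eq_sym (negbTE zNo) /=.
have -> : uniq (p1 ++ z :: rev q1).
  rewrite cat_uniq up1 cons_uniq mem_rev rev_uniq uq1 /= zq1 !andbT.
  apply/norP; split=> //; apply/hasPn => x; rewrite mem_rev => xq1.
  by apply/negP => /pq/negP; apply; rewrite qE mem_cat xq1.
move=> /(_ isT); rewrite size_cat /= size_rev addnS !ltnS leqn0 addn_eq0 !size_eq0.
case/andP => /eqP p10 /eqP q10.
by move: pE qE ab; rewrite p10 q10 => -[-> _] [-> _]; rewrite eqxx.
Qed.

(** * Root paths, generations and descending paths *)

Section RootedTree.
Context {R : realType} (G : weightedRootedTree R).
Local Notation V := (vertex G).
Local Notation E := (@edges R G).
Local Notation o := (tree_root G).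
Local Notation edge := {fset V}.
Implicit Types (e : edge) (p q : seq V).

Definition root_path p := path (edge_rel E) o p && uniq (o :: p).

Lemma edge_rel_sym : symmetric (edge_rel E).
Proof. by move=> x y; rewrite /edge_rel fsetUC. Qed.

Lemma root_path_unique p q :
  root_path p -> root_path q -> last o p = last o q -> p = q.
Proof.
move=> /andP[pp up] /andP[pq uq].
exact: (simple_path_unique edge_rel_sym (edges_tree G).2).
Qed.

Lemma root_path_take p q : root_path (p ++ q) -> root_path p.
Proof.
rewrite /root_path cat_path -cat_cons cat_uniq.
by move=> /andP[/andP[-> _] /andP[-> _]].
Qed.

Lemma root_path_belast p y : root_path (rcons p y) -> root_path p.
Proof. by rewrite -cats1 => /root_path_take. Qed.

Lemma root_path_last_edge p y : root_path (rcons p y) -> E [fset last o p; y]%fset.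
Proof. by move=> /andP[]; rewrite rcons_path /edge_rel => /andP[_ /set_mem]. Qed.

Lemma root_path_ex x : exists2 p, root_path p & last o p = x.
Proof.
have [p pp <-] := (edges_tree G).1 o x.
have [q pq uq _] := shortenP pp.
by exists q => //; rewrite /root_path pq.
Qed.

Lemma root_path_toP e p : root_path_to e p <->
  exists q y, [/\ p = rcons q y, root_path p & e = [fset last o q; y]%fset].
Proof.
split.
  case=> pp up [s]; case/lastP: p pp up => [|q y] pp up.
    by case: s.
  rewrite -cats1 pairmap_cat /= cats1 => /rcons_inj[_ <-].
  by exists q, y; rewrite /root_path cats1 pp up.
case=> q [y [-> /andP[pp up] ->]]; split=> //.
by rewrite -cats1 pairmap_cat /= cats1; eexists.
Qed.

Lemma root_path_to_edge e p : root_path_to e p -> E e.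
Proof. by move=> /root_path_toP[q [y [-> + ->]]]; exact: root_path_last_edge. Qed.

(** If both paths end at the same vertex of e, uniqueness of simple paths applies. Otherwise they
    cross e in opposite directions, and each would be the other with its last vertex removed. *)
Lemma root_path_to_unique e p q :
  root_path_to e p -> root_path_to e q -> p = q.
Proof.
move=> /root_path_toP[p' [u [pE rp eE]]] /root_path_toP[q' [v [qE rq eE']]].
have rp' : root_path p' by apply: (@root_path_belast _ u); rewrite -pE.
have rq' : root_path q' by apply: (@root_path_belast _ v); rewrite -qE.
have : u \in e by rewrite eE !inE eqxx orbT.
rewrite {1}eE' !inE => /orP[/eqP uE|/eqP uE]; last first.
  by apply: root_path_unique => //; rewrite pE qE !last_rcons.
have pq' : p = q' by apply: root_path_unique => //; rewrite pE last_rcons.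
have : last o p' \in e by rewrite eE !inE eqxx.
rewrite {1}eE' !inE -pq' {1}pE last_rcons => /orP[|] /eqP vE.
  move/andP: rp => [_]; rewrite pE -rcons_cons rcons_uniq => /andP[].
  by rewrite -vE mem_last.
have : size q = size p'.
  by congr size; apply: root_path_unique => //; rewrite qE last_rcons.
by rewrite qE -pq' pE !size_rcons => /eqP; rewrite gtn_eqF // leqW.
Qed.

Lemma edgeE e : E e -> exists x y, x != y /\ e = [fset x; y]%fset.
Proof.
move=> /edges_card2; case eE: (enum_fset e) => [|x [|y []]] // _.
exists x, y; split; last first.
  by apply/fsetP => z; rewrite !inE -[z \in e]/(z \in enum_fset e) eE !inE.
by have := fset_uniq e; rewrite eE /= inE andbT.
Qed.

(** Take the simple path to one endpoint u. If it avoids v, extend it by v; otherwise cut it at v,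
    which removes u, and extend by u. *)
Lemma root_path_to_ex e : E e -> exists p, root_path_to e p.
Proof.
move=> Ee; have [u [v [uv eE]]] := edgeE Ee.
have [p rp pu] := root_path_ex u.
have [vp|vp] := boolP (v \in o :: p); last first.
  exists (rcons p v); apply/root_path_toP; exists p, v; split=> //; last by rewrite pu.
  move: rp => /andP[pp up].
  rewrite /root_path rcons_path pp pu -rcons_cons rcons_uniq vp up.
  by rewrite /edge_rel -eE (mem_set Ee).
have [p1 [p2 [pE p1v]]] : exists p1 p2, p = p1 ++ p2 /\ last o p1 = v.
  by case/path.splitPl: vp => p1 p2 <-; exists p1, p2.
rewrite pE in rp pu; have rp1 := root_path_take rp.
have up1 : u \notin o :: p1.
  move: rp => /andP[_]; rewrite -cat_cons cat_uniq => /and3P[_ /hasPn h _].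
  case: p2 {pE} h pu => [_|z p2 h].
    by rewrite cats0 p1v => vu; rewrite vu eqxx in uv.
  by rewrite last_cat /= => pu; apply: h; rewrite -pu mem_last.
exists (rcons p1 u); apply/root_path_toP; exists p1, u; split=> //; last first.
  by rewrite p1v eE fsetUC.
move: rp1 => /andP[pp upp].
rewrite /root_path rcons_path pp p1v -rcons_cons rcons_uniq up1 upp.
by rewrite /edge_rel fsetUC -eE (mem_set Ee).
Qed.

Lemma generationE e p : root_path_to e p -> generation e = size p.
Proof.
move=> ep; rewrite /generation; apply: xget_unique; first by exists p.
by move=> n [q eq <-]; rewrite (root_path_to_unique ep eq).
Qed.

(** The two edges share a vertex, which allows four coincidences of endpoints. As the lengths differ
    by one, each case either is contradictory or makes the end of p the penultimate vertex of q. *)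
Lemma is_parentP e e' p q : root_path_to e p -> root_path_to e' q ->
  is_parent e e' <-> exists z, q = rcons p z.
Proof.
move=> ep e'q; split; last first.
  case=> z qE; split; try exact: root_path_to_edge ep; try exact: root_path_to_edge e'q.
    move/root_path_toP: (e'q) => [p1 [w [qE' rq e'E]]].
    move: qE'; rewrite qE => /rcons_inj[pp1 zw]; subst p1 w.
    move/root_path_toP: (ep) => [p1 [y [pE rp eE]]].
    split; last first.
      by exists y; [rewrite eE|rewrite e'E pE last_rcons]; rewrite !inE eqxx ?orbT.
    move=> ee'; move: e'q; rewrite -ee' => /(root_path_to_unique ep)/(congr1 size)/eqP.
    by rewrite qE size_rcons ltn_eqF.
  by rewrite (generationE ep) (generationE e'q) qE size_rcons.
case=> Ee Ee' [_ [x xe xe']].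
rewrite (generationE ep) (generationE e'q) => sz.
move/root_path_toP: (ep) => [p1 [y [pE rp eE]]].
move/root_path_toP: (e'q) => [q1 [z [qE rq e'E]]].
have rp1 : root_path p1 by apply: (@root_path_belast _ y); rewrite -pE.
have rq1 : root_path q1 by apply: (@root_path_belast _ z); rewrite -qE.
move: sz; rewrite qE size_rcons => -[] sz.
exists z; congr rcons; apply: root_path_unique => //.
move: xe xe'; rewrite eE e'E !inE.
case/orP=> /eqP -> /orP[] /eqP h.
- have := root_path_unique rp1 rq1 h => /(congr1 size).
  by move/eqP; rewrite sz pE size_rcons ltn_eqF.
- have : p1 = q by apply: root_path_unique => //; rewrite qE last_rcons.
  by move=> /(congr1 size)/eqP; rewrite qE size_rcons sz pE size_rcons ltn_eqF // leqW.
- by rewrite pE last_rcons.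
- have : p = q by apply: root_path_unique => //; rewrite qE pE !last_rcons.
  by move=> /(congr1 size)/eqP; rewrite qE size_rcons sz ltn_eqF.
Qed.

(** Indexed from 0 to agree with [gamma], whose edge [gamma i] has generation i + 1. *)
Definition level n : set edge := [set e | E e /\ generation e = n.+1].

Lemma levelP n e : level n e <-> exists2 p, root_path_to e p & size p = n.+1.
Proof.
split=> [[Ee ge]|[p ep sp]].
  by have [p ep] := root_path_to_ex Ee; exists p; rewrite // -(generationE ep).
by split; [exact: root_path_to_edge ep|rewrite (generationE ep)].
Qed.

Lemma edges_level : E = \bigcup_n level n.
Proof.
apply/seteqP; split=> [e Ee|e [n _ []]//].
have [p ep] := root_path_to_ex Ee.
exists (size p).-1 => //; apply/levelP; exists p => //.
by move/root_path_toP: ep => [q [y [-> _ _]]]; rewrite size_rcons.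
Qed.

Lemma trivIset_level : trivIset [set: nat] level.
Proof. by move=> i j _ _ [e [[_ ge] [_]]]; rewrite ge => -[]. Qed.

Lemma is_parent_level n e e' : level n e -> is_parent e e' -> level n.+1 e'.
Proof. by move=> [_ ge] [_ Ee' _]; rewrite ge. Qed.

Lemma is_parent_unique e1 e2 e : is_parent e1 e -> is_parent e2 e -> e1 = e2.
Proof.
move=> h1 h2; have [[E1 Ee _ _] [E2 _ _ _]] := (h1, h2).
have [p ep] := root_path_to_ex Ee.
have [p1 ep1] := root_path_to_ex E1; have [p2 ep2] := root_path_to_ex E2.
have [z pz] := (is_parentP ep1 ep).1 h1; have [w] := (is_parentP ep2 ep).1 h2.
rewrite pz => /rcons_inj[p12 _]; subst p2.
move/root_path_toP: ep1 => [q [y [qE _ ->]]].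
by move/root_path_toP: ep2 => [q' [y' []]]; rewrite qE => /rcons_inj[<- <-] _ ->.
Qed.

Lemma level_parent n e : level n.+1 e -> exists2 e', level n e' & is_parent e' e.
Proof.
move=> /levelP[p ep sp].
move/root_path_toP: (ep) => [q [y [pE rp eE]]].
case/lastP: q => [|q z] in pE eE; first by rewrite pE in sp.
have rq : root_path (rcons q z) by apply: (@root_path_belast _ y); rewrite -pE.
have e'q : root_path_to [fset last o q; z]%fset (rcons q z).
  by apply/root_path_toP; exists q, z.
exists [fset last o q; z]%fset.
  by apply/levelP; exists (rcons q z) => //; move: sp; rewrite pE size_rcons => -[].
by apply/(is_parentP e'q ep); exists y.
Qed.

Lemma level0_root e : E e -> o \in e -> level 0 e.
Proof.
move=> Ee oe.
have [y [oy eE]] : exists y, o != y /\ e = [fset o; y]%fset.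
  have [u [v [uv eE]]] := edgeE Ee.
  move: oe; rewrite {1}eE !inE => /orP[] /eqP ->; first by exists v.
  by exists u; rewrite eq_sym uv fsetUC.
apply/levelP; exists [:: y] => //; apply/root_path_toP; exists [::], y; split=> //.
by rewrite /root_path /= !andbT inE oy /edge_rel -eE (mem_set Ee).
Qed.

Lemma level0P e : level 0 e <-> E e /\ o \in e.
Proof.
split=> [/levelP[p ep sp]|[]]; last exact: level0_root.
split; first exact: root_path_to_edge ep.
move/root_path_toP: ep => [q [y [pE _ ->]]].
by move: sp; rewrite pE size_rcons => -[/size0nil ->]; exact: fset21.
Qed.

Lemma Gamma_infty_level gamma i : Gamma_infty G gamma -> level i (gamma i).
Proof.
move=> [[x [x0 _ xE]] par]; elim: i => [|i IH]; last exact: is_parent_level (par i).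
by apply/level0P; have [? gE] := xE 0%N; split=> //; rewrite gE x0 fset21.
Qed.

(** Successive root paths extend one another, so their endpoints form one vertex sequence. Two equal
    entries would both occur in a single root path, which has no repetition. *)
Lemma Gamma_infty_chain gamma :
  level 0 (gamma 0%N) -> (forall i, is_parent (gamma i) (gamma i.+1)) ->
  Gamma_infty G gamma.
Proof.
move=> g0 par; split=> //.
have gE i : E (gamma i) by have [] := par i.
have /choice[p gp] : forall i, exists p, root_path_to (gamma i) p.
  by move=> i; exact: root_path_to_ex.
have sp i : size (p i) = i.+1.
  elim: i => [|i IH]; first by rewrite -(generationE (gp 0%N)); case: g0.
  have [_ _ _ genS] := par i.
  by rewrite -(generationE (gp i.+1)) genS (generationE (gp i)) IH.
pose x i := if i is i'.+1 then last o (p i') else o.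
have pE i : p i = mkseq (x \o succn) i.+1.
  elim: i => [|i IH].
    by have := sp 0%N; rewrite /mkseq /= /x; case: (p 0%N) => [|y []].
  have [z pz] := (is_parentP (gp i) (gp i.+1)).1 (par i).
  by rewrite mkseqS -IH /= pz last_rcons.
exists x; split=> //.
  move=> i j xij; pose n := maxn i j.
  have /andP[_ up] : root_path (p n).
    by move/root_path_toP: (gp n) => [q [y []]].
  have oE : o :: p n = mkseq x n.+2 by rewrite pE /mkseq /= (iotaDl 1 1) -map_comp.
  rewrite oE in up; apply: (mkseq_uniqP _ _ up) => //; rewrite inE.
    by rewrite !ltnS (leq_trans (leq_maxl i j)).
  by rewrite !ltnS (leq_trans (leq_maxr i j)).
move=> i; split=> //.
move/root_path_toP: (gp i) => [q [y [qE _ ->]]].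
have -> : last o q = x i.
  case: i qE => [|i] qE.
    by have := sp 0%N; rewrite qE size_rcons => -[/size0nil ->].
  have [z pz] := (is_parentP (gp i) (gp i.+1)).1 (par i).
  by move: qE; rewrite pz => /rcons_inj[<-].
by rewrite /= qE last_rcons.
Qed.

(** * Finite nonempty levels and their partition by parents *)

Hypothesis hV : proper_infinite G.

Lemma finite_children e : E e -> finite_set (children e).
Proof.
have [_ lf _] := hV => Ee.
apply: (@sub_finite_set _ _ (\bigcup_(x in [set` e]) [set e' | E e' /\ x \in e'])).
  by move=> e' [_ Ee' [_ [x xe xe']] _]; exists x.
by apply: bigcup_finite => // x _; exact: lf.
Qed.

Lemma finite_level n : finite_set (level n).
Proof.
elim: n => [|n IH].
  have [_ lf _] := hV; apply: (sub_finite_set _ (lf o)).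
  by move=> e /level0P.
apply: (@sub_finite_set _ _ (\bigcup_(e in level n) children e)).
  by move=> e /level_parent[e' e'n e'e]; exists e'.
by apply: bigcup_finite => // e [Ee _]; exact: finite_children.
Qed.

Lemma level_neq0 n : level n !=set0.
Proof.
elim: n => [|n [e en]]; last first.
  have [_ _ /(_ e en.1)[e' ee']] := hV.
  by exists e'; exact: is_parent_level ee'.
(* An infinite vertex set contains a vertex other than the root, and its root path starts with an
   edge of level 0. *)
have [Vinf _ _] := hV.
have [y oy] : exists y, o != y.
  apply: contrapT => /forallNP h; apply: Vinf.
  apply: (sub_finite_set _ (finite_set1 o)) => y _ /=.
  by apply/esym/eqP/negPn/negP/h.
have [[|z p] rp pE] := root_path_ex y; first by rewrite -pE eqxx in oy.
have rz := @root_path_take [:: z] p rp.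
exists [fset o; z]%fset; apply/level0P; split; last exact: fset21.
exact: (@root_path_last_edge [::] z).
Qed.

(** Parents exist and are unique, so the sets of children of level n partition level n + 1. *)
Lemma sum_level_children (U : nmodType) n (f : edge -> U) :
  \sum_(e <- fset_set (level n.+1)) f e =
  \sum_(e <- fset_set (level n)) \sum_(e' <- fset_set (children e)) f e'.
Proof.
have -> : fset_set (level n.+1) =
    (\bigcup_(e <- fset_set (level n)) fset_set (children e))%fset.
  apply/finmap.fsetP => e.
  rewrite in_fset_set; last exact: finite_level.
  apply/idP/bigfcupP => [/set_mem/level_parent[e' e'n e'e]|[e' /andP[]]].
    exists e'.
      by rewrite andbT in_fset_set; [exact: mem_set|exact: finite_level].
    by rewrite in_fset_set; [exact: mem_set|exact: finite_children e'n.1].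
  rewrite (in_fset_set (finite_level n)).
  move=> /set_mem en _; rewrite in_fset_set; last exact: finite_children en.1.
  by move=> /set_mem ee; apply: mem_set; exact: is_parent_level ee.
rewrite partition_disjoint_bigfcup //.
move=> i j; rewrite !(in_fset_set (finite_level n)).
move=> /set_mem[Ei _] /set_mem[Ej _] ij; apply/fdisjointP => e.
rewrite !in_fset_set; try exact: finite_children.
move=> /set_mem ie; apply/negP => /set_mem je.
by move/eqP: ij; apply; exact: is_parent_unique je.
Qed.

(** * Averages over a generation *)

Definition level_size n : nat := #|` fset_set (level n)|.

Definition level_average n (f : edge -> R) : R :=
  (level_size n)%:R^-1 * \sum_(e <- fset_set (level n)) f e.

Lemma level_size_gt0 n : (0 < level_size n)%N.
Proof.
rewrite cardfs_gt0; apply/fset0Pn; have [e en] := level_neq0 n.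
by exists e; rewrite in_fset_set; [exact: mem_set|exact: finite_level].
Qed.

Lemma children_fset_neq0 e : E e -> (fset_set (children e) : seq edge) != [::].
Proof.
move=> Ee; rewrite -size_eq0 -lt0n cardfs_gt0; apply/fset0Pn.
have [_ _ /(_ e Ee)[e' ee']] := hV; exists e'.
by rewrite in_fset_set; [exact: mem_set|exact: finite_children].
Qed.

Hypothesis radial : forall e e', E e -> E e' -> generation e = generation e' ->
    (children e #= children e')%card.

(** Radial symmetry gives every edge of level n the same number c of children, so averaging over
    children and then over parents weighs all edges of the next level equally. *)
Lemma level_average_children n f :
  level_average n (fun e => #|` fset_set (children e)|%:R^-1 *
    \sum_(e' <- fset_set (children e)) f e') = level_average n.+1 f.
Proof.
have [e0 e0n] := level_neq0 n.
pose c := #|` fset_set (children e0)|.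
have chE e : level n e -> #|` fset_set (children e)| = c.
  move=> [Ee ge]; have [Ee0 ge0] := e0n.
  apply/fcard_eq; try exact: finite_children.
  by apply: radial => //; rewrite ge ge0.
have inF e : e \in fset_set (level n) -> level n e.
  by rewrite in_fset_set; [move/set_mem|exact: finite_level].
have szS : level_size n.+1 = (level_size n * c)%N.
  rewrite /level_size card_fset_sum1 sum_level_children.
  rewrite (eq_big_seq (fun=> c)); last first.
    by move=> e /inF en; rewrite -card_fset_sum1 chE.
  by rewrite -sum1_size big_distrl /=; apply: eq_bigr => e _; rewrite mul1n.
rewrite /level_average sum_level_children szS natrM invfM -mulrA; congr (_ * _).
by rewrite big_distrr /=; apply: eq_big_seq => e /inF en; rewrite chE.
Qed.

(** * A path no longer than average *)

Section Potential.
Variable rho : edge -> R.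
Hypothesis rho0 : forall e, 0 <= rho e.

(** The expected value of [rho] after k moves from e, each to a uniformly random child. *)
Fixpoint descendant_average k e : R :=
  if k is k'.+1 then #|` fset_set (children e)|%:R^-1 *
    \sum_(e' <- fset_set (children e)) descendant_average k' e'
  else rho e.

Lemma descendant_average_ge0 k e : 0 <= descendant_average k e.
Proof.
elim: k e => [|k IH] e //=.
by rewrite mulr_ge0 ?invr_ge0 ?ler0n // sumr_ge0.
Qed.

Lemma level_average_descendant k n :
  level_average n (descendant_average k) = level_average (n + k) rho.
Proof.
elim: k n => [|k IH] n; first by rewrite addn0.
by rewrite level_average_children IH addSnnS.
Qed.

Local Open Scope ereal_scope.

(* The expected length of the path which starts with e and moves to a uniformly
   random child at each step. *)
Definition mean_length e : \bar R := \sum_(0 <= k <oo) (descendant_average k e)%:E.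

Lemma mean_length_ge0 e : 0 <= mean_length e.
Proof. by apply: nneseries_ge0 => k _ _; rewrite lee_fin descendant_average_ge0. Qed.

Lemma sum_mean_length (s : seq edge) (c : R) :
  c%:E * \sum_(e <- s) mean_length e =
  \sum_(0 <= k <oo) (c * \sum_(e <- s) descendant_average k e)%:E.
Proof.
rewrite -nneseries_sum; last by move=> *; rewrite lee_fin descendant_average_ge0.
rewrite -nneseriesZl; last first.
  by move=> i _; apply: sume_ge0 => e _; rewrite lee_fin descendant_average_ge0.
by apply: eq_eseriesr => k _; rewrite sumEFin EFinM.
Qed.

(** The mean length at e is [rho e] plus the average of the mean lengths of its children, and some
    child is at most that average. *)
Lemma mean_length_child e : E e ->
  exists2 e', is_parent e e' & (rho e)%:E + mean_length e' <= mean_length e.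
Proof.
move=> Ee.
have [e' e'c le] := seq_le_average mean_length (children_fset_neq0 Ee).
exists e'; first by move: e'c; rewrite in_fset_set; [move/set_mem|exact: finite_children].
rewrite [leRHS]/mean_length nneseries_recl //; last first.
  by move=> k _; rewrite lee_fin descendant_average_ge0.
rewrite leeD2l // (le_trans le) // sum_mean_length.
rewrite -(@nneseries_addn _ _ 1); last by move=> k; rewrite lee_fin descendant_average_ge0.
by under [leRHS]eq_eseriesr do rewrite addn1.
Qed.

Lemma short_path e : level 0 e ->
  exists2 gamma, Gamma_infty G gamma & path_length rho gamma <= mean_length e.
Proof.
move=> e0.
(* The implication makes [next] a total function; its values off the edge set are arbitrary. *)
have /choice[next nextP] : forall e, exists e', E e ->
    is_parent e e' /\ (rho e)%:E + mean_length e' <= mean_length e.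
  move=> e1; have [Ee|nEe] := pselect (E e1); last by exists e1.
  by have [e' ? ?] := mean_length_child Ee; exists e'.
pose gamma i := iter i next e.
have gE i : E (gamma i).
  by elim: i => [|i IH]; [case: e0|have [[]] := nextP _ IH].
exists gamma.
  by apply: Gamma_infty_chain => // i; have [] := nextP _ (gE i).
(* Invariant of the greedy path: length so far plus expected remaining length never exceeds the
   initial expectation. *)
have part n :
    \sum_(0 <= i < n) (rho (gamma i))%:E + mean_length (gamma n) <= mean_length e.
  elim: n => [|n IH]; first by rewrite big_nil add0e.
  rewrite big_nat_recr //= -addeA (le_trans _ IH) // leeD2l //.
  by have [] := nextP _ (gE n).
apply: lime_le; first by apply: is_cvg_nneseries => i _ _; rewrite lee_fin.
apply: nearW => n; apply: (le_trans _ (part n)).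
by rewrite leeDl // mean_length_ge0.
Qed.

(** Start the greedy path at a level 0 edge whose mean length is at most the average over level 0;
    that average is the sum of all generation averages. *)
Lemma sum_level_average_ge1 :
  (forall gamma, Gamma_infty G gamma -> 1 <= path_length rho gamma) ->
  1 <= \sum_(0 <= n <oo) (level_average n rho)%:E.
Proof.
move=> adm.
have ne : (fset_set (level 0) : seq edge) != [::].
  by rewrite -size_eq0 -lt0n level_size_gt0.
have [e e0 le] := seq_le_average mean_length ne.
have {}e0 : level 0 e by move: e0; rewrite in_fset_set; [move/set_mem|exact: finite_level].
have [gamma /adm len lg] := short_path e0.
rewrite (le_trans len) // (le_trans lg) // (le_trans le) // sum_mean_length.
by under eq_eseriesr do rewrite -/(level_average 0 _) level_average_descendant.
Qed.

End Potential.

(** * The formula for the modulus *)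

Hypothesis radial_weight : forall e e', E e -> E e' ->
  generation e = generation e' -> weight e = weight e'.

Definition level_mass n : R := \sum_(e <- fset_set (level n)) weight e.

Lemma mem_level n e : e \in fset_set (level n) -> level n e.
Proof. by rewrite (in_fset_set (finite_level n)) => /set_mem. Qed.

Lemma level_massE n e : level n e -> level_mass n = (level_size n)%:R * weight e.
Proof.
move=> [Ee ge]; rewrite /level_mass (eq_big_seq (fun=> weight e)).
  by rewrite big_const_seq count_predT iter_addr_0 mulr_natl.
by move=> e' /mem_level[Ee' ge']; apply: radial_weight => //; rewrite ge.
Qed.

Lemma level_mass_gt0 n : 0 < level_mass n.
Proof.
have [e en] := level_neq0 n.
by rewrite (level_massE en) mulr_gt0 ?ltr0n ?level_size_gt0 // weight_gt0 //; case: en.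
Qed.

Lemma energyE (p : R) (rho : edge -> R) : energy p rho =
  (\sum_(0 <= n <oo)
    (\sum_(e <- fset_set (level n)) weight e * rho e `^ p)%R%:E)%E.
Proof.
(* Terms are nonnegative on edges, so absolute values change nothing there; they give the form
   needed to split the sum over the disjoint levels. *)
rewrite /energy (eq_esum (b := fun e => `|weight e * rho e `^ p|%:E)); last first.
  move=> e Ee; rewrite ger0_norm // mulr_ge0 ?powR_ge0 //; exact/ltW/weight_gt0.
rewrite edges_level nneseries_sum_bigcup;
  [|exact: trivIset_level|by move=> e; rewrite lee_fin].
apply: eq_eseriesr => n _.
rewrite esum_fset; [|exact: finite_level|by move=> *; rewrite lee_fin].
rewrite fsbig_finite; last exact: finite_level.
rewrite sumEFin; congr EFin; apply: eq_big_seq => e /mem_level[Ee _].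
by rewrite ger0_norm // mulr_ge0 ?powR_ge0 //; exact/ltW/weight_gt0.
Qed.

Let w := dual_weight level_mass.
Let w_gt0 (p : R) n : 0 < w p n := dual_weight_gt0 level_mass_gt0 p n.

(** Young's inequality on each edge, with c = w_n/W the optimal density, is weighted and summed over
    the level. The factor of the average is free of n, so these bounds can be added over
    generations. *)
Lemma level_energy_ge (p W : R) n (rho : edge -> R) :
  1 < p -> 0 < W -> (forall e, 0 <= rho e) ->
  p * W `^ (1 - p) * level_average n rho <=
  \sum_(e <- fset_set (level n)) weight e * rho e `^ p +
  (p - 1) * W `^ (1 - p) / W * w p n.
Proof.
move=> p1 W0 rho0; set c := w p n / W.
have c0 : 0 < c by rewrite divr_gt0.
have [e0 e0n] := level_neq0 n.
have mE := level_massE e0n.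
have N0 : (level_size n)%:R != 0 :> R by rewrite pnatr_eq0 -lt0n level_size_gt0.
have -> : p * W `^ (1 - p) * level_average n rho =
    \sum_(e <- fset_set (level n)) weight e * (p * (rho e * c `^ (p - 1))).
  rewrite -(dual_weight_scaled_powRB1 level_mass_gt0 n p1 W0) -/c mE /level_average.
  rewrite [X in X = _](_ : _ = p * weight e0 * c `^ (p - 1) *
     \sum_(e <- fset_set (level n)) rho e); last by field.
  rewrite big_distrr /=; apply: eq_big_seq => e /mem_level[Ee ge].
  rewrite (radial_weight Ee e0n.1); last by rewrite ge e0n.2.
  ring.
have -> : (p - 1) * W `^ (1 - p) / W * w p n =
    \sum_(e <- fset_set (level n)) weight e * ((p - 1) * c `^ p).
  rewrite -big_distrl /= -/(level_mass n) mulrCA.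
  rewrite (dual_weight_scaled_powR level_mass_gt0 n p1 W0) -/(w p n); ring.
rewrite -big_split /= big_seq [leRHS]big_seq; apply: ler_sum => e /mem_level[Ee _].
rewrite -mulrDr ler_wpM2l ?young_powR //; exact/ltW/weight_gt0.
Qed.

Local Open Scope ereal_scope.

Lemma Modulus_ge (p W : R) : (1 < p)%R -> (0 < W)%R ->
  \sum_(0 <= n <oo) (w p n)%:E = W%:E ->
  (W `^ (1 - p))%:E <= Modulus G p (Gamma_infty G).
Proof.
move=> p1 W0 WE; apply/ereal_infP => _ [rho [rho0 adm] <-].
(* [Adm] gives nonnegativity on edges only, whereas the averaging lemmas ask for it everywhere. *)
pose rho' e := `|rho e|%R.
have rho'E e : E e -> rho' e = rho e by move=> Ee; rewrite /rho' ger0_norm // rho0.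
have -> : energy p rho = energy p rho'.
  by apply: eq_esum => e Ee; rewrite rho'E.
have len1 : 1 <= \sum_(0 <= n <oo) (level_average n rho')%:E.
  apply: sum_level_average_ge1; first by move=> e; exact: normr_ge0.
  move=> gamma Gg; rewrite (le_trans (adm _ Gg)) // /path_length.
  rewrite le_eqVlt; apply/orP; left; apply/eqP; apply: eq_eseriesr => i _.
  by rewrite rho'E //; have [] := Gamma_infty_level i Gg.
set K := (W `^ (1 - p))%R.
have K0 : (0 < K)%R by exact: powR_gt0.
have en0 n : (0 <= \sum_(e <- fset_set (level n)) weight e * rho' e `^ p)%R.
  rewrite big_seq; apply: sumr_ge0 => e /mem_level[Ee _].
  by rewrite mulr_ge0 ?powR_ge0 // ltW // weight_gt0.
have av0 n : (0 <= level_average n rho')%R.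
  by rewrite mulr_ge0 ?invr_ge0 ?ler0n //; apply: sumr_ge0 => e _; exact: normr_ge0.
have c0 : (0 <= (p - 1) * K / W)%R.
  by rewrite !mulr_ge0 ?invr_ge0 ?subr_ge0 // ltW.
(* Adding the level bounds, with averages summing to at least 1, yields this; subtracting the finite
   term (p-1)K leaves K as a lower bound for the energy. *)
have : (p * K)%:E <= energy p rho' + ((p - 1) * K)%:E.
  have -> : ((p - 1) * K)%:E = \sum_(0 <= n <oo) ((p - 1) * K / W * w p n)%:E.
    under eq_eseriesr do rewrite EFinM.
    rewrite nneseriesZl; last by move=> n _; rewrite lee_fin ltW.
    by rewrite WE -EFinM divfK // gt_eqF.
  rewrite energyE -nneseriesD; last 2 first.
  - by move=> n _ _; rewrite lee_fin.
  - by move=> n _ _; rewrite lee_fin mulr_ge0 // ltW.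
  apply: (@le_trans _ _ (\sum_(0 <= n <oo) (p * K * level_average n rho')%:E)).
    under eq_eseriesr do rewrite EFinM.
    rewrite nneseriesZl; last by move=> n _; rewrite lee_fin.
    rewrite -[leLHS]mule1 lee_wpmul2l // lee_fin mulr_ge0 ?ltW //; lra.
  apply: lee_nneseries => [n _ _|n _].
    by rewrite lee_fin mulr_ge0 // mulr_ge0 ?ltW //; lra.
  by rewrite -EFinD lee_fin level_energy_ge // => e; exact: normr_ge0.
case: (energy p rho') => [x| |]; [|by move=> _; rewrite leey|by rewrite addNye leeNy_eq].
rewrite -EFinD !lee_fin => le; rewrite -(lerD2r ((p - 1) * K)).
by apply: le_trans le; rewrite le_eqVlt; apply/orP; left; apply/eqP; ring.
Qed.

(** The optimal density is cut off after m generations and renormalised to length 1. It is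
    admissible even if the full series diverges, which lets [ModulusE] deduce convergence. *)
Lemma Modulus_le (p : R) m : (1 < p)%R -> (0 < m)%N ->
  Modulus G p (Gamma_infty G) <= ((\sum_(0 <= n < m) w p n)%R `^ (1 - p))%:E.
Proof.
move=> p1 m0; set W := (\sum_(0 <= n < m) w p n)%R.
have W0 : (0 < W)%R.
  rewrite /W big_ltn // ltr_pwDl // sumr_ge0 // => n _; exact: ltW.
pose f n : R := if (n < m)%N then (w p n / W)%R else 0%R.
have f0 n : (0 <= f n)%R by rewrite /f; case: ifP => // _; rewrite divr_ge0 ?ltW.
pose rho e := f (generation e).-1.
have rhoE n e : level n e -> rho e = f n by move=> [_ ge]; rewrite /rho ge.
apply: (@le_trans _ _ (energy p rho)).
  apply: ereal_inf_lbound; exists rho => //; split=> [e _|gamma Gg]; first exact: f0.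
  rewrite /path_length.
  have -> : \sum_(0 <= i <oo) (rho (gamma i))%:E = \sum_(0 <= i <oo) (f i)%:E.
    by apply: eq_eseriesr => i _; rewrite (rhoE i) //; exact: Gamma_infty_level.
  rewrite -[leLHS](_ : \sum_(0 <= n < m) (f n)%:E = 1).
    by apply: nneseries_lim_ge => n _ _; rewrite lee_fin.
  rewrite sumEFin; congr EFin; rewrite (eq_big_nat _ _ (F2 := fun n => (w p n / W)%R)).
    by rewrite -big_distrl /= divff // gt_eqF.
  by move=> n /andP[_ nm]; rewrite /f nm.
rewrite energyE (nneseries_split 0 m); last first.
  move=> n _; rewrite lee_fin; rewrite big_seq; apply: sumr_ge0 => e /mem_level[Ee _].
  by rewrite mulr_ge0 ?powR_ge0 // ltW // weight_gt0.
have enE n : (\sum_(e <- fset_set (level n)) weight e * rho e `^ p =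
    level_mass n * f n `^ p)%R.
  rewrite /level_mass big_distrl /=; apply: eq_big_seq => e /mem_level en.
  by rewrite (rhoE n).
(* Beyond the cutoff the density vanishes, and 0^p = 0 because p is nonzero. *)
rewrite [X in _ + X]eseries0 ?adde0 => [|n mn _]; last first.
  rewrite enE /f ltnNge mn /= powR0 ?mulr0 //; rewrite gt_eqF //; lra.
rewrite add0n sumEFin lee_fin.
rewrite (eq_big_nat _ _ (F2 := fun n => (W `^ (1 - p) / W * w p n)%R)).
  by rewrite -big_distrr /= -/W divfK // gt_eqF.
move=> n /andP[_ nm]; rewrite enE /f nm.
by rewrite (dual_weight_scaled_powR level_mass_gt0 n p1 W0) -/(w p n) mulrA mulrAC.
Qed.

(** The cutoff bound at m = 1 makes the modulus a finite x. Since x > 0, all the cutoff bounds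
    together keep the partial sums below x^(-1/(p-1)); so the series converges, and the same bound
    on its sum gives the upper estimate. *)
Lemma ModulusE (p : R) : (1 < p)%R -> 0 < Modulus G p (Gamma_infty G) ->
  exists W : R, [/\ (0 < W)%R, \sum_(0 <= n <oo) (w p n)%:E = W%:E &
    Modulus G p (Gamma_infty G) = (W `^ (1 - p))%:E].
Proof.
move=> p1.
have := fun m => @Modulus_le p m p1; have := fun W => @Modulus_ge p W p1.
case: (Modulus G p (Gamma_infty G)) => [x| |] //= ge le x0; last first.
  by have := le 1%N isT; rewrite leye_eq.
rewrite lte_fin in x0.
have Wm m : (0 < m)%N -> (0 < \sum_(0 <= n < m) w p n)%R.
  move=> m0; rewrite big_ltn // ltr_pwDl // sumr_ge0 // => n _; exact: ltW.
have WmB m : (\sum_(0 <= n < m) w p n <= x `^ (- (p - 1)^-1))%R.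
  case: m => [|m]; first by rewrite big_nil powR_ge0.
  by have := le m.+1 isT; rewrite lee_fin le_powR_onem ?Wm.
have WB : \sum_(0 <= n <oo) (w p n)%:E <= (x `^ (- (p - 1)^-1))%:E.
  apply: lime_le; first by apply: is_cvg_nneseries => n _ _; rewrite lee_fin ltW.
  by apply: nearW => m; rewrite sumEFin lee_fin.
have : \sum_(0 <= n < 1) (w p n)%:E <= \sum_(0 <= n <oo) (w p n)%:E.
  by apply: nneseries_lim_ge => n _ _; rewrite lee_fin ltW.
rewrite big_nat1.
case WE : (\sum_(0 <= n <oo) (w p n)%:E) WB => [W| |] //=.
rewrite !lee_fin => WB W1; have W0 : (0 < W)%R := lt_le_trans (w_gt0 p 0) W1.
exists W; split=> //; apply/eqP; rewrite eq_le ge // andbT.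
by rewrite lee_fin le_powR_onem.
Qed.

End RootedTree.

(** * Continuity in p *)

Theorem theorem8 (R : realType) (G : weightedRootedTree R)
    (hG : radially_symmetric_tree G) (hsigma : radially_symmetric_weight G)
    (p0 : R) (hp0 : 1 < p0)
    (hMod : \forall p \near p0, (0 < Modulus G p (Gamma_infty G))%E) :
  {for p0, continuous (fun p : R => Modulus G p (Gamma_infty G))}.
Proof.
have [hV radial] := hG.
pose w := dual_weight (level_mass G).
have s_gt0 n : 0 < level_mass G n by exact: level_mass_gt0.
pose W p := fine (\sum_(0 <= n <oo) (w p n)%:E)%E.
have WP p : 1 < p -> (0 < Modulus G p (Gamma_infty G))%E ->
    [/\ 0 < W p, (\sum_(0 <= n <oo) (w p n)%:E)%E = (W p)%:E &
        Modulus G p (Gamma_infty G) = (W p `^ (1 - p))%:E].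
  move=> p1 /(ModulusE hV radial hsigma p1)[W' [W'0 W'E ->]].
  by rewrite /W -/w W'E.
move/nbhs_ballP: hMod => [e /= e0 he].
(* Halving keeps even the endpoints p0 - d and p0 + d inside the ball of positivity and above 1, so
   the dual series converges at both. *)
pose d := Num.min (e / 2) ((p0 - 1) / 2).
have d0 : 0 < d by rewrite lt_min !divr_gt0 ?subr_gt0.
have [de d1] : d <= e / 2 /\ d <= (p0 - 1) / 2.
  by split; rewrite ge_min lexx ?orbT.
have near_p0 p : p0 - d <= p <= p0 + d ->
    1 < p /\ (0 < Modulus G p (Gamma_infty G))%E.
  move=> /andP[ap pb]; split; first by lra.
  by apply: he; rewrite /ball /= ltr_norml; apply/andP; split; lra.
have near_in : \forall p \near p0, p0 - d <= p <= p0 + d.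
  apply/nbhs_ballP; exists d => //= p; rewrite /ball /= ltr_norml => /andP[h1 h2].
  by apply/andP; split; lra.
have dd : 0 <= d by exact: ltW.
have [a1 Ma] : 1 < p0 - d /\ (0 < Modulus G (p0 - d) (Gamma_infty G))%E.
  by apply: near_p0; apply/andP; split; lra.
have [b1 Mb] : 1 < p0 + d /\ (0 < Modulus G (p0 + d) (Gamma_infty G))%E.
  by apply: near_p0; apply/andP; split; lra.
(* The dominating series is the sum of the dual series at the two endpoints. *)
have Wcont : {for p0, continuous W}.
  apply: (@continuous_dominated_series _ (fun n p => w p n)
    (fun n => w (p0 - d) n + w (p0 + d) n)).
  - by move=> n p; exact: powR_ge0.
  - under eq_eseriesr do rewrite EFinD.
    rewrite nneseriesD; try by move=> n _ _; rewrite lee_fin powR_ge0.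
    by have [_ -> _] := WP _ a1 Ma; have [_ -> _] := WP _ b1 Mb; rewrite -EFinD ltry.
  - by apply: filterS near_in => p pab n; exact: dual_weight_le.
  - by move=> n; exact: continuous_dual_weight.
(* Base and exponent both vary with p; since W p > 0, the exponential form reduces continuity to a
   product and compositions. It is valid only near p0, hence the passage through [near_eq_cvg]. *)
have expE p : p0 - d <= p <= p0 + d ->
    Modulus G p (Gamma_infty G) = (expR ((1 - p) * ln (W p)))%:E.
  move=> /near_p0[p1 Mp]; have [W0 _ ->] := WP p p1 Mp.
  by rewrite /powR gt_eqF.
have W0 : 0 < W p0 by have [] := WP p0 hp0 (he p0 (ballxx _ e0)).
rewrite /prop_for /continuous_at expE; last by apply/andP; split; lra.
apply: cvg_trans (near_eq_cvg _) _.
  by apply: filterS near_in => p /expE ->.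
apply: cvg_EFin; first exact: nearW.
apply: continuous_cvg; first exact: continuous_expR.
apply: cvgM; first by apply: cvgB; [exact: cvg_cst|exact: cvg_id].
by apply: continuous_cvg => //; exact: continuous_ln.
Qed.
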